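(* Let $\|\cdot\|$ be a norm on $\mathbb{R}^d$, with associated coordinate-$k$ norms $\|\cdot\|_{(k)}$ and dual coordinate-$k$ norms $\|\cdot\|_{(k),\star}$ (unit balls $B_{(k),\star}$), $k\in\{1,\dots,d\}$. For any function $\varphi:\{0,1,\dots,d\}\to[0,+\infty)$ such that $\varphi(j)>\varphi(0)=0$ for all $j\in\{1,\dots,d\}$, there exists a norm $\|\cdot\|_{(\varphi)}$ on $\mathbb{R}^d$ characterized (i) either by its dual norm $\|\cdot\|_{(\varphi),\star}$, whose unit ball $B_{(\varphi),\star}$ is $\bigcap_{j\in\{1,\dots,d\}}\varphi(j)B_{(j),\star}$, that is, $$B_{(\varphi),\star}=\bigcap_{j\in\{1,\dots,d\}}\varphi(j)B_{(j),\star}\quad\text{and}\quad\|\cdot\|_{(\varphi)}=\sigma_{B_{(\varphi),\star}},$$ or, equivalently, $$\|y\|_{(\varphi),\star}=\sup_{j\in\{1,\dots,d\}}\frac{\|y\|_{(j),\star}}{\varphi(j)},\qquad\forall y\in\mathbb{R}^d;$$ (ii) or by the inf-convolution of the functions $\varphi(j)\|\cdot\|_{(j)}$, $j\in\{1,\dots,d\}$, that is, $$\|x\|_{(\varphi)}=\inf_{\substack{z^{(1)}\in\mathbb{R}^d,\dots,z^{(d)}\in\mathbb{R}^d\\ \sum_{j=1}^dz^{(j)}=x}}\ \sum_{j=1}^d\varphi(j)\|z^{(j)}\|_{(j)},\qquad\forall x\in\mathbb{R}^d.$$ Then, for all $x\in\mathbb{R}^d\setminus\{0\}$, $$\frac{\|x\|_{(\varphi)}}{\|x\|}\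 \le\ \frac{1}{\|x\|}\min_{\substack{z^{(1)}\in\mathbb{R}^d,\dots,z^{(d)}\in\mathbb{R}^d\\ \sum_{j=1}^d\|z^{(j)}\|_{(j)}\le\|x\|\\ \sum_{j=1}^dz^{(j)}=x}}\ \sum_{j=1}^d\varphi(j)\|z^{(j)}\|_{(j)}\ \le\ \varphi(\ell_0(x)).$$
   Context: $d\ge 1$ is an integer and $\langle\cdot,\cdot\rangle$ is the Euclidean scalar product on $\mathbb{R}^d$. For $x\in\mathbb{R}^d$, $\ell_0(x)\in\{0,\dots,d\}$ is the number of nonzero components of $x$. For $K\subset\{1,\dots,d\}$, $\mathcal{R}_K=\{x\in\mathbb{R}^d : x_j=0\ \forall j\notin K\}$, and for $y\in\mathbb{R}^d$, $y_K\in\mathcal{R}_K$ coincides with $y$ on the components in $K$ and is zero outside $K$. The support function of $A\subset\mathbb{R}^d$ is $\sigma_A(x)=\sup_{y\in A}\langle x,y\rangle$. For $K\subset\{1,\dots,d\}$ and $y\in\mathcal{R}_K$, $\|y\|_{K,\star}=\sup\{\langle x,y\rangle : x\in\mathcal{R}_K,\ \|x\|\le 1\}$. The dual coordinate-$k$ norm is $\|y\|_{(k),\star}=\sup_{K\subset\{1,\dots,d\},\,|K|\le k}\|y_K\|_{K,\star}$ for $y\in\mathbb{R}^d$ (this is a norm), with unit ball $B_{(k),\star}=\{y:\|y\|_{(k),\star}\le1\}$, and the coordinate-$k$ norm is the norm whose dual norm is $\|\cdot\|_{(k),\star}$: $\|x\|_{(k)}=\sup\{\langle x,y\rangle:\|y\|_{(k),\star}\le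 1\}$. *)

(* Defs.v *)
From mathcomp Require Import all_boot all_order all_algebra.
From mathcomp Require Import all_classical all_reals ereal.

Set Implicit Arguments.
Unset Strict Implicit.
Unset Printing Implicit Defensive.

Import Order.TTheory GRing.Theory Num.Theory.

Local Open Scope classical_set_scope.
Local Open Scope ring_scope.

(* Vectors of R^d are rows 'rV[R]_d.  A norm is a plain function subject to
   [is_norm], since several norms on the same space are compared and 'rV[R]_d
   already carries the (unrelated) canonical sup norm. *)

Section CoordinateNorms.
Variables (R : realType) (d : nat).
Local Notation V := 'rV[R]_d.
Implicit Types (x y : V) (N : V -> R) (K : {set 'I_d}) (A : set V).

Definition is_norm N : Prop :=
  [/\ forall x, 0 <= N x,
      forall x, N x = 0 <-> x = 0,
      forall (a : R) x, N (a *: x) = `|a| * N x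
    & forall x y, N (x + y) <= N x + N y].

Definition dot x y : R := \sum_(i < d) x 0 i * y 0 i.

Definition l0_count x : nat := #|[pred i | x 0 i != 0]|.

Lemma l0_count_ltn x : (l0_count x < d.+1)%N.
Proof. by rewrite ltnS -[X in (_ <= X)%N]card_ord max_card. Qed.

Definition l0 x : 'I_d.+1 := Ordinal (l0_count_ltn x).

(* Possibly infinite, hence extended-real valued. *)
Definition support_fun A x : \bar R := ereal_sup [set (dot x y)%:E | y in A].

Definition coord_subspace K : set V := [set x | forall i, i \notin K -> x 0 i = 0].

Definition coord_proj K y : V := \row_i (if i \in K then y 0 i else 0).

(* The real-valued [sup]s below are genuine suprema (nonempty bounded sets)
   when [N] is a norm, 1 <= d, and, for [coord_norm], 1 <= k. *)
Definition dual_norm N y : R := sup [set dot x y | x in [set x | N x <= 1]].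

Definition dual_norm_on N K y : R :=
  sup [set dot x y | x in coord_subspace K `&` [set x | N x <= 1]].

Definition dual_coord_norm N (k : nat) y : R :=
  sup [set dual_norm_on N K (coord_proj K y)
      | K in [set K : {set 'I_d} | (#|K| <= k)%N]].

Definition dual_coord_ball N (k : nat) : set V :=
  [set y | dual_coord_norm N k y <= 1].

Definition coord_norm N (k : nat) x : R :=
  sup [set dot x y | y in dual_coord_ball N k].

Definition dual_ball N : set V := [set y | dual_norm N y <= 1].

(* An index j in {1, ..., d} is encoded by i : 'I_d with j = i.+1; the
   corresponding element of {0, ..., d} = 'I_d.+1 is [lift ord0 i]. *)

Definition phi_ball N (phi : 'I_d.+1 -> R) : set V :=
  \bigcap_(i in [set: 'I_d])
    [set phi (lift ord0 i) *: y | y in dual_coord_ball N i.+1].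

Definition phi_dual_norm N (phi : 'I_d.+1 -> R) y : R :=
  sup [set dual_coord_norm N i.+1 y / phi (lift ord0 i) | i in [set: 'I_d]].

Definition phi_cost N (phi : 'I_d.+1 -> R) (z : 'I_d -> V) : R :=
  \sum_(i < d) phi (lift ord0 i) * coord_norm N i.+1 (z i).

Definition phi_inf_conv N (phi : 'I_d.+1 -> R) x : R :=
  inf [set phi_cost N phi z | z in [set z : 'I_d -> V | \sum_(i < d) z i = x]].

Definition is_min (S : set R) (m : R) : Prop := S m /\ lbound S m.

End CoordinateNorms.

(* Main.v *)
Require Import Defs.
From mathcomp Require Import all_boot all_order all_algebra.
From mathcomp Require Import all_classical all_reals ereal.
From mathcomp Require Import topology normedtype derive.
From mathcomp Require Import lra.

Set Implicit Arguments.
Unset Strict Implicit.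
Unset Printing Implicit Defensive.

Import Order.TTheory GRing.Theory Num.Theory.
Import numFieldNormedType.Exports.

Local Open Scope classical_set_scope.
Local Open Scope ring_scope.

(** All the norms involved are determined by their dual norms: in finite
dimension a norm has a supporting linear form at every point
([norm_supporting]), hence coincides with its bidual ([bidual_norm]) and with
the support function of its dual unit ball ([norm_support_fun]).  Taking the
inf-convolution [inf_conv] of finitely many norms as the definition of the
sought norm, Hoelder's inequality on each summand and the choice of
decompositions with a single nonzero term show that its dual norm is the
maximum of the dual norms ([dual_inf_conv_le]).  Applied to the norms
[phi j * coord_norm j], whose duals are [dual_coord_norm j / phi j], this gives
the descriptions by the dual ball, by the dual norm and by inf-convolution at
the same time, and biduality gives uniqueness.

For the last inequalities, write [l] for the number of nonzero entries of [x].
Dropping the constraint on [sum_j coord_norm j (z j)] only enlarges the set of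
decompositions, whence the lower bound.  For the upper bound, the decomposition
whose only nonzero term is [z l = x] is admissible because
[coord_norm l x <= nrm x] ([coord_norm_sparse]): only the restriction of a dual
vector to the support of [x], a set of [l] indices, matters in its product with
[x].  The minimum is attained because the cost is continuous and the admissible
decompositions form a compact set ([constrained_min]).

Two classical facts are proved along the way: every norm dominates a multiple
of the sup norm ([norm_coercive], by compactness of the sphere), so that all
the suprema are finite and sublevel sets are bounded; and every sublinear
function has a supporting linear form ([sublinear_supporting], the
finite-dimensional Hahn-Banach theorem). *)

(** * Seminorms, continuity and coercivity *)

Section Seminorms.
Variables (R : realType) (n : nat).
Local Notation V := 'rV[R]_n.
Implicit Types (x y z : V) (p N : V -> R).

Definition is_seminorm p : Prop :=
  (forall (a : R) x, p (a *: x) = `|a| * p x)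
  /\ (forall x y, p (x + y) <= p x + p y).

Lemma is_norm_seminorm N : is_norm N -> is_seminorm N.
Proof. by case. Qed.

Lemma seminorm0 p : is_seminorm p -> p 0 = 0.
Proof. by case=> hZ _; rewrite -(scale0r 0) hZ normr0 mul0r. Qed.

Lemma seminormN p x : is_seminorm p -> p (- x) = p x.
Proof. by case=> hZ _; rewrite -scaleN1r hZ normrN1 mul1r. Qed.

Lemma seminorm_ge0 p x : is_seminorm p -> 0 <= p x.
Proof.
move=> hp; have := hp.2 x (- x); rewrite subrr seminorm0// seminormN//; lra.
Qed.

Lemma seminorm_sum p (I : finType) (z : I -> V) :
  is_seminorm p -> p (\sum_i z i) <= \sum_i p (z i).
Proof.
move=> hp; elim/big_ind2: _ => [|x a y b le1 le2|//]; first by rewrite seminorm0.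
by rewrite (le_trans (hp.2 _ _))// lerD.
Qed.

Lemma seminorm_eqP p x : is_seminorm p -> (forall z, p z = 0 -> z = 0) ->
  p x = 0 <-> x = 0.
Proof. by move=> hp hd; split=> [/hd //|->]; rewrite seminorm0. Qed.

Lemma seminorm_is_norm p : is_seminorm p -> (forall z, p z = 0 -> z = 0) ->
  is_norm p.
Proof.
move=> hp hd; split=> [x|x||]; [exact: seminorm_ge0|exact: seminorm_eqP| |].
- exact: hp.1.
- exact: hp.2.
Qed.

Lemma norm_ge0 N x : is_norm N -> 0 <= N x.
Proof. by case. Qed.

Lemma norm_gt0 N x : is_norm N -> x != 0 -> 0 < N x.
Proof.
case=> N0 Ne _ _ x0; rewrite lt_neqAle N0 andbT eq_sym.
by apply: contraNneq x0 => /Ne ->.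
Qed.

Lemma coord_le_norm x i : `|x 0 i| <= `|x|.
Proof.
rewrite [leRHS]/Num.norm /= mx_normrE.
by apply/bigmax_geP; right => /=; exists (0, i).
Qed.

(** Expanding [x] in the canonical basis. *)
Lemma seminorm_bounded p : is_seminorm p ->
  exists2 C, 0 <= C & forall x, p x <= C * `|x|.
Proof.
move=> hp; exists (\sum_i p (delta_mx 0 i)) => [|x].
  by apply: sumr_ge0 => i _; exact: seminorm_ge0.
rewrite {1}(row_sum_delta x) (le_trans (seminorm_sum _ hp))//.
rewrite mulr_suml; apply: ler_sum => i _; rewrite hp.1 mulrC.
by rewrite ler_wpM2l ?seminorm_ge0// coord_le_norm.
Qed.

(** The modulus of continuity is an arbitrary seminorm, rather than a multiple
of the sup norm, in order to cover both seminorms and their composites with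
translations and linear maps. *)
Lemma seminorm_lipschitz_continuous p (f : V -> R) : is_seminorm p ->
  (forall x y, f x - f y <= p (x - y)) -> continuous f.
Proof.
move=> hp hf x; have [C C0 hC] := seminorm_bounded hp.
apply/(@cvgrPdist_le _ _ _ (nbhs x)) => e e0; apply/nbhs_ballP.
exists (e / (C + 1)) => [|y]; first by rewrite /= divr_gt0// ltr_wpDl.
rewrite mx_norm_ball /ball_/= => /ltW xy.
have hpe : p (x - y) <= e.
  rewrite (le_trans (hC _))// (le_trans (ler_wpM2l C0 xy))//.
  rewrite mulrCA ger_pMr// ler_pdivrMr ?mul1r ?lerDl// ltr_wpDl//.
have hyx := hf y x; rewrite -(opprB x y) seminormN// in hyx.
by rewrite ler_norml; have hxy := hf x y; apply/andP; split; lra.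
Qed.

Lemma seminorm_dist p x y : is_seminorm p -> p x - p y <= p (x - y).
Proof. by move=> hp; have := hp.2 (x - y) y; rewrite subrK; lra. Qed.

Lemma seminorm_continuous p : is_seminorm p -> continuous p.
Proof.
by move=> hp; apply: (seminorm_lipschitz_continuous hp) => x y; exact: seminorm_dist.
Qed.

(** The constant is the minimum of [N] on the sphere of the sup norm, which is
compact. *)
Lemma norm_coercive N : is_norm N ->
  exists2 c, 0 < c & forall x, c * `|x| <= N x.
Proof.
move=> hN; have hs := is_norm_seminorm hN.
pose S : set V := [set x | `|x| = 1].
have normS x : x != 0 -> S (`|x|^-1 *: x).
  by move=> x0; rewrite /S/= normrZ normfV normr_id mulVf ?normr_eq0.
(* In dimension 0 the sphere is empty. *)
have [S0|S0] := pselect (S !=set0); last first.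
  exists 1 => // x; have [->|x0] := eqVneq x 0.
    by rewrite normr0 mulr0; exact: seminorm_ge0.
  by case: S0; exists (`|x|^-1 *: x); exact: normS.
have cS : compact S.
  apply: bounded_closed_compact.
    by exists 1; split=> // M M1 x /= ->; exact: ltW.
  apply: (closed_comp (f := fun x : V => `|x|) (D := [set 1])).
    by move=> x _; exact: norm_continuous.
  exact: closed_eq.
have [|x0 Sx0 min] := compact_EVT_min S0 cS (f := N).
  by apply: continuous_subspaceT => x; exact: seminorm_continuous.
exists (N x0).
  apply: norm_gt0 => //; move: Sx0; rewrite inE /S/= => Sx0.
  by rewrite -normr_eq0 Sx0 oner_eq0.
move=> x; have [->|xn0] := eqVneq x 0.
  by rewrite normr0 mulr0; exact: seminorm_ge0.
have := min _ (mem_set (normS _ xn0)).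
by rewrite hs.1 normfV normr_id ler_pdivlMl ?normr_gt0// mulrC.
Qed.

End Seminorms.

(** Scaling by the inverse scalar turns the inequality into an equality. *)
Lemma le_homogeneous_seminorm (R : realType) n (p : 'rV[R]_n -> R) :
  (forall (a : R) x, p (a *: x) <= `|a| * p x) ->
  (forall x y, p (x + y) <= p x + p y) -> is_seminorm p.
Proof.
move=> hZ hD; split=> // a x; apply/eqP; rewrite eq_le hZ/=.
have [->|a0] := eqVneq a 0.
  by rewrite normr0 mul0r scale0r; have := hD 0 0; rewrite addr0; lra.
have := hZ a^-1 (a *: x); rewrite scalerA mulVf// scale1r normfV.
by rewrite ler_pdivlMl ?normr_gt0.
Qed.

(** * Supporting linear forms of sublinear functions *)

Section HahnBanach.
Variables (R : realType) (n : nat).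
Local Notation V := 'rV[R]_n.
Implicit Types (x y z v : V) (p q N : V -> R).

Definition sublinear p : Prop :=
  (forall (a : R) x, 0 < a -> p (a *: x) = a * p x)
  /\ (forall x y, p (x + y) <= p x + p y).

Lemma sublinear0 p : sublinear p -> p 0 = 0.
Proof. by case=> hZ _; have := hZ 2 0 (ltr0n _ 2); rewrite scaler0; lra. Qed.

Lemma sublinear_opp_ge p x : sublinear p -> - p (- x) <= p x.
Proof. by move=> hp; have := hp.2 x (- x); rewrite subrr sublinear0//; lra. Qed.

(** One step of the Hahn-Banach argument.  The function
[q x = inf_(t >= 0) (p (x + t v) - t p v)] is again sublinear, because the
infimum is taken over a cone on which the expression is jointly sublinear;
[t = 0] gives [q <= p], and [t = 1] gives [q (- v) <= - p v], which makes [q]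
odd along [v]. *)
Lemma sublinear_linearize p v : sublinear p ->
  exists q, [/\ sublinear q, forall x, q x <= p x & q (- v) <= - p v].
Proof.
move=> hp; have hp0 := sublinear0 hp.
have pZ (t : R) x : 0 <= t -> p (t *: x) = t * p x.
  rewrite le_eqVlt => /predU1P[<-|/hp.1//]; by rewrite scale0r mul0r.
pose S x : set R := [set p (x + t *: v) - t * p v | t in [set t : R | 0 <= t]].
have lbS x : lbound (S x) (- p (- x)).
  move=> _ [t /= t0 <-].
  have := hp.2 (x + t *: v) (- x); rewrite addrAC subrr add0r pZ//; lra.
have inS x t : 0 <= t -> inf (S x) <= p (x + t *: v) - t * p v.
  by move=> t0; apply: ge_inf; [exists (- p (- x)); exact: lbS|exists t].
have leS x c : (forall t, 0 <= t -> c <= p (x + t *: v) - t * p v) ->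
    c <= inf (S x).
  move=> h; apply: lb_le_inf; first by exists (p (x + 0 *: v) - 0 * p v), 0 => /=.
  by move=> _ [t /= t0 <-]; exact: h.
exists (fun x => inf (S x)); split; last 2 first.
- by move=> x; have := inS x 0 (lexx _); rewrite scale0r addr0 mul0r subr0.
- by have := inS (- v) 1 ler01; rewrite scale1r addNr hp0 mul1r add0r.
have scal (a : R) x : 0 < a -> inf (S (a *: x)) <= a * inf (S x).
  move=> a0; rewrite -ler_pdivrMl//; apply: leS => t t0; rewrite ler_pdivrMl//.
  have at0 : 0 <= a * t by rewrite mulr_ge0// ltW.
  by rewrite (le_trans (inS _ _ at0))// -scalerA -scalerDr hp.1// -mulrA -mulrBr.
split=> [a x a0|x y].
- apply/eqP; rewrite eq_le scal//=.
  have := @scal a^-1 (a *: x); rewrite scalerA mulVf ?gt_eqF// scale1r invr_gt0.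
  by move=> /(_ a0); rewrite ler_pdivlMl.
- rewrite -lerBlDl; apply: (leS _) => s s0; rewrite lerBlDr -lerBlDl.
  apply: leS => t t0; rewrite lerBlDl.
  rewrite (le_trans (inS _ _ (addr_ge0 s0 t0)))//.
  have := hp.2 (x + t *: v) (y + s *: v).
  by rewrite scalerDl [s *: v + _]addrC -[x + y + _]addrACA; lra.
Qed.

(** Oddness along a vector is inherited by every smaller sublinear function,
so the directions can be treated one after the other. *)
Lemma sublinear_linearize_seq p (vs : seq V) : sublinear p ->
  exists q, [/\ sublinear q, forall x, q x <= p x
    & forall v, v \in vs -> q (- v) = - q v].
Proof.
move=> hp; elim: vs => [|v vs [q [hq qp IH]]]; first by exists p.
have [r [hr rq rv]] := sublinear_linearize v hq.
exists r; split=> // [x|w]; first exact: le_trans (rq _) (qp _).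
have := sublinear_opp_ge w hr; rewrite inE => ge /orP[/eqP wv|/IH qw].
  by move: ge rv (rq v); rewrite wv; lra.
by move: ge qw (rq w) (rq (- w)); lra.
Qed.

Lemma dotC x y : dot x y = dot y x.
Proof. by apply: eq_bigr => i _; rewrite mulrC. Qed.

Lemma dotDl x y z : dot (x + y) z = dot x z + dot y z.
Proof. by rewrite -big_split; apply: eq_bigr => i _; rewrite mxE mulrDl. Qed.

Lemma dotZl (a : R) x z : dot (a *: x) z = a * dot x z.
Proof. by rewrite mulr_sumr; apply: eq_bigr => i _; rewrite mxE mulrA. Qed.

Lemma dotDr x y z : dot z (x + y) = dot z x + dot z y.
Proof. by rewrite !(dotC z) dotDl. Qed.

Lemma dotZr (a : R) x z : dot z (a *: x) = a * dot z x.
Proof. by rewrite !(dotC z) dotZl. Qed.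

Lemma dot0l y : dot 0 y = 0.
Proof. by rewrite -(scale0r 0) dotZl mul0r. Qed.

Lemma dot_suml (I : finType) (z : I -> V) y :
  dot (\sum_i z i) y = \sum_i dot (z i) y.
Proof.
by elim/big_ind2: _ => [|a b c e <- <-|//]; rewrite ?dot0l ?dotDl.
Qed.

Lemma dot_delta i y : dot (delta_mx 0 i) y = y 0 i.
Proof.
rewrite /dot (bigD1 i)//= mxE !eqxx mul1r big1 ?addr0// => j ji.
by rewrite mxE (negbTE ji) andbF mul0r.
Qed.

Lemma dot_self_eq0 x : dot x x <= 0 -> x = 0.
Proof.
move=> le; apply/rowP => i; rewrite mxE; apply/eqP.
rewrite -sqrf_eq0 eq_le sqr_ge0 andbT expr2 (le_trans _ le)// /dot (bigD1 i)//=.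
by rewrite lerDl sumr_ge0// => j _; rewrite -expr2 sqr_ge0.
Qed.

(** Linearizing first along [x0] freezes the value at [x0]; linearizing then
along the canonical basis leaves a linear form. *)
Lemma sublinear_supporting p x0 : sublinear p ->
  exists2 y, dot x0 y = p x0 & forall x, dot x y <= p x.
Proof.
move=> hp.
have [q [hq qp qv]] := sublinear_linearize x0 hp.
have [r [hr rq odd]] :=
  sublinear_linearize_seq [seq delta_mx 0 i | i <- enum 'I_n] hq.
have rB (x : V) : r x <= dot x (\row_i r (delta_mx 0 i)).
  rewrite {1}(row_sum_delta x) /dot.
  elim/big_ind2: _ => [|a b c e le1 le2|i _]; first by rewrite sublinear0.
    by rewrite (le_trans (hr.2 _ _))// lerD.
  rewrite mxE; have oddi : r (- delta_mx 0 i) = - r (delta_mx 0 i).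
    by apply: odd; apply/map_f; rewrite mem_enum.
  have [xi|xi|->] := ltgtP (x 0 i) 0; last by rewrite scale0r mul0r sublinear0.
    by rewrite -[x 0 i *: _]opprK -scaleNr -scalerN hr.1 ?oppr_gt0// oddi mulrNN.
  by rewrite hr.1.
have rE (x : V) : dot x (\row_i r (delta_mx 0 i)) <= r x.
  have := sublinear_opp_ge x hr; have := rB (- x).
  by rewrite -scaleN1r dotZl; lra.
exists (\row_i r (delta_mx 0 i)) => [|x]; last first.
  exact: le_trans (le_trans (rq _) (qp _)).
have := rB x0; have := rE x0; have := qp x0; have := rq x0.
have := rq (- x0); have := sublinear_opp_ge x0 hr; lra.
Qed.

End HahnBanach.
(** * Dual norms and biduality *)

Section DualNorm.
Variables (R : realType) (n : nat).
Local Notation V := 'rV[R]_n.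
Implicit Types (x y z : V) (N : V -> R) (K : {set 'I_n}).

Lemma dot_bounded N y : is_norm N ->
  exists B, forall x, N x <= 1 -> dot x y <= B.
Proof.
move=> hN; have [c c0 hc] := norm_coercive hN.
have [|C C0 hC] := seminorm_bounded (p := fun x => `|dot x y|).
  split=> [a x|x z]; first by rewrite dotZl normrM.
  by rewrite dotDl ler_normD.
exists (C * c^-1) => x Nx; rewrite (le_trans (ler_norm _))// (le_trans (hC x))//.
by rewrite ler_wpM2l// -[c^-1]mulr1 ler_pdivlMl// (le_trans (hc x)).
Qed.

Lemma dual_norm_on_le N K y c : is_norm N ->
  (forall x, coord_subspace K x -> N x <= 1 -> dot x y <= c) ->
  dual_norm_on N K y <= c.
Proof.
move=> hN h; apply: ge_sup; last by move=> _ [x [Kx Nx] <-]; exact: h.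
exists (dot 0 y), 0 => //; split=> /= [i _|]; first by rewrite mxE.
by rewrite (seminorm0 (is_norm_seminorm hN)) ler01.
Qed.

Lemma dual_norm_on_ub N K x y : is_norm N -> coord_subspace K x -> N x <= 1 ->
  dot x y <= dual_norm_on N K y.
Proof.
move=> hN Kx Nx; apply: ub_le_sup; last by exists x.
by have [B hB] := dot_bounded y hN; exists B => _ [z [_ Nz] <-]; exact: hB.
Qed.

Lemma dot_le_dual_norm_on N K x y : is_norm N -> coord_subspace K x ->
  dot x y <= N x * dual_norm_on N K y.
Proof.
move=> hN Kx; have hs := is_norm_seminorm hN; have [->|x0] := eqVneq x 0.
  by rewrite dot0l seminorm0// mul0r.
have Nx : 0 < N x by exact: norm_gt0.
rewrite -ler_pdivrMl// -dotZl dual_norm_on_ub//.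
  by move=> i iK; rewrite mxE Kx// mulr0.
by rewrite hs.1 gtr0_norm ?invr_gt0// mulVf// gt_eqF.
Qed.

Lemma dual_norm_on_ge0 N K y : is_norm N -> 0 <= dual_norm_on N K y.
Proof.
move=> hN; rewrite -(dot0l y) dual_norm_on_ub//.
  by move=> i _; rewrite mxE.
by rewrite (seminorm0 (is_norm_seminorm hN)) ler01.
Qed.

Lemma dual_norm_on_seminorm N K : is_norm N -> is_seminorm (dual_norm_on N K).
Proof.
move=> hN; have hs := is_norm_seminorm hN.
apply: le_homogeneous_seminorm => [a y|y z]; apply: dual_norm_on_le => // x Kx Nx.
  rewrite dotZr -dotZl (le_trans (dot_le_dual_norm_on _ hN (K := K) _))//.
    by move=> i iK; rewrite mxE Kx// mulr0.
  rewrite ler_wpM2r ?dual_norm_on_ge0// hs.1.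
  by rewrite -[leRHS]mulr1 ler_wpM2l.
by rewrite dotDr lerD// dual_norm_on_ub.
Qed.

(** The dual norm is the instance of [dual_norm_on] for the full set of
indices, so its properties need not be proved separately. *)
Lemma dual_normE N y : dual_norm N y = dual_norm_on N [set: 'I_n]%SET y.
Proof.
rewrite /dual_norm_on; congr (sup (image _ _)).
apply/seteqP; split=> x /=; last by case.
by split=> // i; rewrite inE.
Qed.

Lemma coord_subspaceT x : coord_subspace [set: 'I_n]%SET x.
Proof. by move=> i; rewrite inE. Qed.

Lemma dual_norm_le N y c : is_norm N ->
  (forall x, N x <= 1 -> dot x y <= c) -> dual_norm N y <= c.
Proof. by move=> hN h; rewrite dual_normE dual_norm_on_le// => x _; exact: h. Qed.

Lemma dot_le_dual_norm N x y : is_norm N -> dot x y <= N x * dual_norm N y.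
Proof.
by move=> hN; rewrite dual_normE dot_le_dual_norm_on//; exact: coord_subspaceT.
Qed.

(** Definiteness holds because [dot y y <= N y * dual_norm N y]. *)
Lemma dual_norm_is_norm N : is_norm N -> is_norm (dual_norm N).
Proof.
move=> hN; have -> : dual_norm N = dual_norm_on N [set: 'I_n]%SET.
  by apply/funext => y; exact: dual_normE.
apply: seminorm_is_norm => [|y y0]; first exact: dual_norm_on_seminorm.
by apply: dot_self_eq0; have := dot_le_dual_norm y y hN; rewrite dual_normE y0 mulr0.
Qed.

Lemma dot_le_norm N x y : is_norm N -> dual_norm N y <= 1 -> dot x y <= N x.
Proof.
move=> hN Ny; rewrite (le_trans (dot_le_dual_norm _ _ hN))//.
by rewrite -[leRHS]mulr1 ler_wpM2l// norm_ge0.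
Qed.

Lemma norm_supporting N x : is_norm N ->
  exists2 y, dual_norm N y <= 1 & dot x y = N x.
Proof.
move=> hN; have [|y xy yN] := sublinear_supporting (p := N) x.
  case: hN => _ _ hZ hD; split=> // a z a0; by rewrite hZ gtr0_norm.
exists y => //; apply: dual_norm_le => // z Nz; exact: le_trans (yN z) Nz.
Qed.

(** One inequality is that of the definition of the dual norm, the other one
tests the bidual norm on a supporting linear form. *)
Lemma bidual_norm N x : is_norm N -> dual_norm (dual_norm N) x = N x.
Proof.
move=> hN; have hd := dual_norm_is_norm hN.
apply/eqP; rewrite eq_le; apply/andP; split.
  by apply: dual_norm_le => // y Ny; rewrite dotC dot_le_norm.
have [y Ny <-] := norm_supporting x hN.
rewrite dotC (le_trans (dot_le_dual_norm _ _ hd))// -[leRHS]mul1r ler_wpM2r//.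
exact/norm_ge0/dual_norm_is_norm.
Qed.

(** The bidual norm is a supremum over the dual unit ball. *)
Lemma norm_eq_of_dual_ball N N' : is_norm N -> is_norm N' ->
  dual_ball N' = dual_ball N -> N' = N.
Proof.
move=> hN hN' e; apply/funext => x.
rewrite -(bidual_norm x hN) -(bidual_norm x hN').
by rewrite /dual_norm -/(dual_norm N) -/(dual_norm N') -/(dual_ball N')
           -/(dual_ball N) e.
Qed.

Lemma norm_support_fun N x : is_norm N ->
  (N x)%:E = support_fun (dual_ball N) x.
Proof.
move=> hN; apply/eqP; rewrite eq_le; apply/andP; split.
  have [y Ny <-] := norm_supporting x hN.
  by apply: ereal_sup_ubound; exists y.
by apply: ge_ereal_sup => _ [y Ny <-]; rewrite lee_fin dot_le_norm.
Qed.

Lemma scaled_norm_is_norm N a : 0 < a -> is_norm N -> is_norm (fun x => a * N x).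
Proof.
move=> a0 [N0 Ne NZ ND]; apply: seminorm_is_norm => [|z /eqP].
  split=> [b x|x y]; first by rewrite NZ mulrCA.
  by rewrite -mulrDr ler_wpM2l// ltW.
by rewrite mulf_eq0 gt_eqF//= => /eqP/Ne.
Qed.

Lemma dual_scaled_norm N a y : 0 < a -> is_norm N ->
  dual_norm (fun x => a * N x) y = dual_norm N y / a.
Proof.
move=> a0 hN; have ha := scaled_norm_is_norm a0 hN.
apply/eqP; rewrite eq_le; apply/andP; split.
  apply: dual_norm_le => // x; rewrite -ler_pdivlMl// mulr1 => Nx.
  rewrite (le_trans (dot_le_dual_norm _ _ hN))// mulrC ler_wpM2l//.
  exact/norm_ge0/dual_norm_is_norm.
rewrite ler_pdivrMr//; apply: dual_norm_le => // x Nx.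
rewrite (le_trans (dot_le_dual_norm x y ha))// mulrC ler_wpM2l//.
  exact/norm_ge0/dual_norm_is_norm.
by rewrite -[leRHS]mulr1 ler_wpM2l// ltW.
Qed.

End DualNorm.

(** * Coordinate norms *)

Section CoordinateNorms.
Variables (R : realType) (d : nat) (N : 'rV[R]_d -> R).
Hypothesis hN : is_norm N.
Local Notation V := 'rV[R]_d.
Implicit Types (x y : V) (K : {set 'I_d}) (k : nat).

(** Vectors supported in [K] do not see the entries of [y] outside [K]. *)
Lemma dual_norm_on_proj K y : dual_norm_on N K (coord_proj K y) = dual_norm_on N K y.
Proof.
rewrite /dual_norm_on; congr sup; apply: eq_imagel => x [Kx _].
apply: eq_bigr => i _; rewrite mxE; case: ifP => // /negbT /Kx ->.
by rewrite !mul0r.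
Qed.

Lemma dual_norm_on_le_dual_norm K y : dual_norm_on N K y <= dual_norm N y.
Proof.
apply: dual_norm_on_le => // x _ Nx; rewrite dual_normE dual_norm_on_ub//.
exact: coord_subspaceT.
Qed.

Lemma dual_coord_norm_le k y c :
  (forall K, (#|K| <= k)%N -> dual_norm_on N K y <= c) ->
  dual_coord_norm N k y <= c.
Proof.
move=> h; apply: ge_sup => [|_ [K /= Kk <-]]; last by rewrite dual_norm_on_proj h.
exists (dual_norm_on N finset.set0 (coord_proj finset.set0 y)), finset.set0 => //.
by rewrite /= cards0.
Qed.

Lemma dual_norm_on_le_coord k K y : (#|K| <= k)%N ->
  dual_norm_on N K y <= dual_coord_norm N k y.
Proof.
move=> Kk; apply: ub_le_sup; last by exists K => //; rewrite dual_norm_on_proj.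
exists (dual_norm N y) => _ [J _ <-].
by rewrite dual_norm_on_proj dual_norm_on_le_dual_norm.
Qed.

(** Definiteness is where [0 < k] matters: the singletons are then among the
index sets, and they detect each entry. *)
Lemma dual_coord_norm_is_norm k : (0 < k)%N -> is_norm (dual_coord_norm N k).
Proof.
move=> k0; apply: seminorm_is_norm => [|y y0].
  apply: le_homogeneous_seminorm => [a y|y z]; apply: dual_coord_norm_le => K Kk.
    rewrite (dual_norm_on_seminorm K hN).1 ler_wpM2l//.
    exact: dual_norm_on_le_coord.
  rewrite (le_trans ((dual_norm_on_seminorm K hN).2 _ _))// lerD//;
  exact: dual_norm_on_le_coord.
apply/rowP => i; rewrite mxE; apply/eqP; rewrite -sqrf_eq0 eq_le sqr_ge0 andbT.
have le0 : dual_norm_on N [set i]%SET y <= 0.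
  by rewrite -y0 dual_norm_on_le_coord// cards1.
rewrite expr2 -{2}(dot_delta i y) -dotZl.
rewrite (le_trans (dot_le_dual_norm_on (K := [set i]%SET) _ hN _))//.
  by move=> j; rewrite inE !mxE => /negbTE ->; rewrite mulr0.
by rewrite mulr_ge0_le0// norm_ge0.
Qed.

Lemma coord_normE k : coord_norm N k = dual_norm (dual_coord_norm N k).
Proof.
by apply/funext => x; congr sup; apply: eq_imagel => y _; rewrite dotC.
Qed.

Lemma coord_norm_is_norm k : (0 < k)%N -> is_norm (coord_norm N k).
Proof.
by move=> k0; rewrite coord_normE; exact/dual_norm_is_norm/dual_coord_norm_is_norm.
Qed.

Lemma dual_coord_normE k y : (0 < k)%N ->
  dual_norm (coord_norm N k) y = dual_coord_norm N k y.
Proof.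
by move=> k0; rewrite coord_normE bidual_norm//; exact: dual_coord_norm_is_norm.
Qed.

Lemma l0_count_gt0 x : x != 0 -> (0 < l0_count x)%N.
Proof.
move=> x0; rewrite lt0n; apply: contra_neq x0 => /card0_eq h; apply/rowP => i.
by apply/eqP; have := h i; rewrite inE mxE => /negbT; rewrite negbK.
Qed.

(** The support of [x] is one of the index sets over which
[dual_coord_norm] takes its supremum. *)
Lemma coord_norm_sparse x : x != 0 -> coord_norm N (l0_count x) x <= N x.
Proof.
move=> x0; pose K : {set 'I_d} := [set i | x 0 i != 0]%SET.
have cK : #|K| = l0_count x by rewrite cardsE.
rewrite coord_normE; apply: dual_norm_le => [|y Dy].
  exact/dual_coord_norm_is_norm/l0_count_gt0.
rewrite dotC (le_trans (dot_le_dual_norm_on (K := K) _ hN _))//.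
  by move=> i; rewrite inE negbK => /eqP.
rewrite -[leRHS]mulr1 ler_wpM2l//.
  exact: norm_ge0.
by rewrite (le_trans _ Dy)// dual_norm_on_le_coord// cK.
Qed.

End CoordinateNorms.
(** * Inf-convolution of finitely many norms *)

Section InfConvolution.
Variables (R : realType) (n : nat) (I : finType) (i0 : I).
Variable P : I -> 'rV[R]_n -> R.
Local Notation V := 'rV[R]_n.
Implicit Types (x y : V) (z : I -> V).

Definition single (i : I) x : I -> V := fun j => if j == i then x else 0.

Definition inf_conv x : R :=
  inf [set \sum_i P i (z i) | z in [set z : I -> V | \sum_i z i = x]].

Lemma sum_single i x : \sum_j single i x j = x.
Proof. by rewrite -big_mkcond big_pred1_eq. Qed.

Lemma sum_norm_single i x (Q : I -> V -> R) : (forall j, is_seminorm (Q j)) ->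
  \sum_j Q j (single i x j) = Q i x.
Proof.
move=> hQ; rewrite (bigD1 i)//= /single eqxx big1 ?addr0// => j /negbTE ->.
exact: seminorm0.
Qed.

Lemma le_inf_conv x c :
  (forall z, \sum_i z i = x -> c <= \sum_i P i (z i)) -> c <= inf_conv x.
Proof.
move=> h; apply: lb_le_inf; last by move=> _ [z zx <-]; exact: h.
by exists (\sum_i P i (single i0 x i)), (single i0 x) => //=; exact: sum_single.
Qed.

Hypothesis hP : forall i, is_norm (P i).

Let sP i : is_seminorm (P i). Proof. exact: is_norm_seminorm. Qed.

Lemma inf_conv_le z : inf_conv (\sum_i z i) <= \sum_i P i (z i).
Proof.
apply: ge_inf; last by exists z.
exists 0 => _ [w _ <-]; apply: sumr_ge0 => i _; exact: seminorm_ge0.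
Qed.

Lemma inf_conv_le1 i x : inf_conv x <= P i x.
Proof. by rewrite -{1}(sum_single i x) -(sum_norm_single i x sP) inf_conv_le. Qed.

Lemma inf_conv_seminorm : is_seminorm inf_conv.
Proof.
apply: le_homogeneous_seminorm => [a x|x y].
  have [->|a0] := eqVneq a 0.
    rewrite scale0r normr0 mul0r (le_trans (inf_conv_le1 i0 0))//.
    by rewrite seminorm0.
  rewrite -ler_pdivrMl ?normr_gt0//; apply: le_inf_conv => z <-.
  rewrite ler_pdivrMl ?normr_gt0// scaler_sumr (le_trans (inf_conv_le _))//.
  by rewrite mulr_sumr ler_sum// => i _; rewrite (sP i).1.
rewrite -lerBlDr; apply: le_inf_conv => z <-; rewrite lerBlDr -lerBlDl.
apply: le_inf_conv => w <-; rewrite lerBlDl -big_split/=.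
rewrite (le_trans (inf_conv_le _))// -big_split/=.
by apply: ler_sum => i _; exact: (sP i).2.
Qed.

(** Hoelder's inequality on each term of a decomposition of [x]. *)
Lemma dot_le_inf_conv x y c : (forall i, dual_norm (P i) y <= c) ->
  dot x y <= c * inf_conv x.
Proof.
move=> h.
have le z : dot (\sum_i z i) y <= c * \sum_i P i (z i).
  rewrite dot_suml mulr_sumr ler_sum// => i _.
  rewrite (le_trans (dot_le_dual_norm _ _ (hP i)))// mulrC ler_wpM2r//.
  exact: seminorm_ge0.
(* The factor [c] can be moved across the infimum only when it is nonzero. *)
have : 0 <= c.
  by rewrite (le_trans _ (h i0))// norm_ge0//; exact: dual_norm_is_norm.
rewrite le_eqVlt => /predU1P[c0|c0].
  by have := le (single i0 x); rewrite sum_single -c0 !mul0r.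
by rewrite -ler_pdivrMl//; apply: le_inf_conv => z <-; rewrite ler_pdivrMl.
Qed.

(** For definiteness, test [x] against itself, with the sum of the dual norms
of [x] as a crude common bound. *)
Lemma inf_conv_is_norm : is_norm inf_conv.
Proof.
apply: seminorm_is_norm => [|x x0]; first exact: inf_conv_seminorm.
apply: dot_self_eq0.
have := @dot_le_inf_conv x x (\sum_i dual_norm (P i) x); rewrite x0 mulr0; apply.
move=> i; rewrite (bigD1 i)//= lerDl sumr_ge0// => j _.
exact/norm_ge0/dual_norm_is_norm.
Qed.

(** The unit ball of an inf-convolution is the convex hull of the unit
balls, so its polar is the intersection of their polars. *)
Lemma dual_inf_conv_le y c :
  dual_norm inf_conv y <= c <-> forall i, dual_norm (P i) y <= c.
Proof.
split=> [h i|h].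
  rewrite (le_trans _ h)//; apply: dual_norm_le => // x Px.
  rewrite (le_trans (dot_le_dual_norm x y inf_conv_is_norm))//.
  rewrite -[leRHS]mul1r ler_wpM2r ?(le_trans (inf_conv_le1 i x))//.
  exact/norm_ge0/dual_norm_is_norm/inf_conv_is_norm.
apply: dual_norm_le => [|x Nx]; first exact: inf_conv_is_norm.
rewrite (le_trans (dot_le_inf_conv x h))// -[leRHS]mulr1 ler_wpM2l//.
rewrite (le_trans _ (h i0))//.
exact/norm_ge0/dual_norm_is_norm.
Qed.

End InfConvolution.

(** * Existence of a minimal constrained decomposition *)

Section ConstrainedMinimum.
Variables (R : realType) (m n : nat).
Local Notation V := 'rV[R]_n.
Implicit Types (x : V) (P Q : 'I_m -> V -> R).

Lemma sum_rows_seminorm P : (forall i, is_seminorm (P i)) ->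
  is_seminorm (fun v : 'rV[R]_(m * n) => \sum_i P i (row i (vec_mx v))).
Proof.
move=> hP; split=> [a v|v w].
  by rewrite mulr_sumr; apply: eq_bigr => i _; rewrite !linearZ/= (hP i).1.
by rewrite -big_split; apply: ler_sum => i _; rewrite !linearD/= (hP i).2.
Qed.

(** Families of [m] vectors, seen as flattened matrices, form a single space of
row vectors, in which closed bounded sets are compact.  The constraint on the [Q i] is itself
a bound on a norm of the family, hence it bounds the admissible set. *)
Lemma constrained_min P Q x r :
  (forall i, is_seminorm (P i)) -> (forall i, is_norm (Q i)) ->
  let F := [set z : 'I_m -> V | \sum_i Q i (z i) <= r /\ \sum_i z i = x] in
  F !=set0 -> exists mu, is_min [set \sum_i P i (z i) | z in F] mu.
Proof.
move=> sP hQ F [z0 Fz0]; have sQ i := is_norm_seminorm (hQ i).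
have nQ : is_norm (fun v : 'rV[R]_(m * n) => \sum_i Q i (row i (vec_mx v))).
  apply: seminorm_is_norm => [|v v0]; first exact: sum_rows_seminorm.
  rewrite -[v]vec_mxK -[0](linear0 mxvec); congr mxvec; apply/row_matrixP => i.
  rewrite row0; case: (hQ i) => _ h0 _ _; apply/h0.
  apply/eqP; move/eqP: v0; rewrite psumr_eq0 => [/allP/(_ i)|j _].
    by apply; rewrite mem_index_enum.
  exact: seminorm_ge0.
(* The linear constraint defines a closed set because the distance from the
   sum of the rows to [x] is continuous. *)
pose L (v : 'rV[R]_(m * n)) := \sum_i row i (vec_mx v).
have sL : is_seminorm (fun v => `|L v|).
  split=> [a v|v w]; rewrite /L.
    by under eq_bigr do rewrite !linearZ/=; rewrite -scaler_sumr normrZ.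
  by under eq_bigr do rewrite !linearD/=; rewrite big_split ler_normD.
have LB v w : L (v - w) = L v - L w.
  by rewrite /L -sumrB; apply: eq_bigr => i _; rewrite !linearB.
pose A : set 'rV[R]_(m * n) :=
  [set v | \sum_i Q i (row i (vec_mx v)) <= r] `&` [set v | `|L v - x| = 0].
pose vec (z : 'I_m -> V) := mxvec (\matrix_i z i).
have vecK (T : nmodType) (G : 'I_m -> V -> T) z :
    \sum_i G i (row i (vec_mx (vec z))) = \sum_i G i (z i).
  by apply: eq_bigr => i _; rewrite mxvecK rowK.
have AF z : F z -> A (vec z).
  case=> Qz Lz; split => /=; first by rewrite vecK.
  by rewrite /L (vecK _ (fun=> id)) Lz subrr normr0.
have A0 : A !=set0 by exists (vec z0); exact: AF.
have cA : compact A.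
  apply: bounded_closed_compact.
    have [c c0 hc] := norm_coercive nQ.
    exists (c^-1 * r); split=> [|M rM v [/= Qv _]]; first exact: num_real.
    by rewrite (le_trans _ (ltW rM))// ler_pdivlMl// (le_trans (hc v)).
  apply: closedI.
    apply: (closed_comp (D := [set t | t <= r]) _ (@closed_le _ r)) => v _.
    exact/seminorm_continuous/is_norm_seminorm.
  apply: (closed_comp (D := [set t | t = 0]) _ (@closed_eq _ 0)) => v _.
  apply: (seminorm_lipschitz_continuous sL) => u w; rewrite LB.
  by rewrite (le_trans (lerB_dist _ _))// opprB addrA subrK.
have [|v Av min] := compact_EVT_min A0 cA
    (f := fun v => \sum_i P i (row i (vec_mx v))).
  apply: continuous_subspaceT => v.
  exact/seminorm_continuous/sum_rows_seminorm.
move: Av; rewrite inE => -[/= Qv /normr0P Lv].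
exists (\sum_i P i (row i (vec_mx v))); split.
  exists (fun i => row i (vec_mx v)) => //; split=> //.
  by apply/eqP; rewrite -subr_eq0.
by move=> _ [z Fz <-]; have := min _ (mem_set (AF z Fz)); rewrite vecK.
Qed.

End ConstrainedMinimum.
(** * The norm associated with phi *)

Section PhiNorm.
Variables (R : realType) (d : nat) (hd : (0 < d)%N) (N : 'rV[R]_d -> R).
Variable phi : 'I_d.+1 -> R.
Hypotheses (hN : is_norm N) (phi_gt0 : forall i : 'I_d, 0 < phi (lift ord0 i)).
Implicit Types (x y : 'rV[R]_d).

Let P (i : 'I_d) x : R := phi (lift ord0 i) * coord_norm N i.+1 x.

Let hP i : is_norm (P i).
Proof. by apply: scaled_norm_is_norm => //; exact: coord_norm_is_norm. Qed.

Lemma phi_inf_conv_is_norm : is_norm (phi_inf_conv N phi).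
Proof. exact: (inf_conv_is_norm (Ordinal hd) hP). Qed.

Lemma phi_inf_conv_le z x : \sum_(i < d) z i = x ->
  phi_inf_conv N phi x <= phi_cost N phi z.
Proof. by move=> <-; exact: inf_conv_le hP z. Qed.

Lemma dual_phi_inf_conv_le y c : dual_norm (phi_inf_conv N phi) y <= c <->
  forall i : 'I_d, dual_coord_norm N i.+1 y / phi (lift ord0 i) <= c.
Proof.
have E i : dual_norm (P i) y = dual_coord_norm N i.+1 y / phi (lift ord0 i).
  by rewrite dual_scaled_norm ?dual_coord_normE//; exact: coord_norm_is_norm.
split=> [/(dual_inf_conv_le (Ordinal hd) hP) h i|h]; first by rewrite -E.
by apply/(dual_inf_conv_le (Ordinal hd) hP) => i; rewrite E.
Qed.

Lemma dual_phi_inf_conv y :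
  dual_norm (phi_inf_conv N phi) y = phi_dual_norm N phi y.
Proof.
have [ub _] := dual_phi_inf_conv_le y (dual_norm (phi_inf_conv N phi) y).
apply/eqP; rewrite eq_le; apply/andP; split.
  apply/dual_phi_inf_conv_le => i; apply: ub_le_sup; last by exists i.
  by exists (dual_norm (phi_inf_conv N phi) y) => _ [j _ <-]; exact: ub.
apply: ge_sup => [|_ [j _ <-]]; last exact: ub.
by eexists; exists (Ordinal hd).
Qed.

Lemma dual_ball_phi_inf_conv : dual_ball (phi_inf_conv N phi) = phi_ball N phi.
Proof.
have hD (i : 'I_d) := dual_coord_norm_is_norm hN (ltn0Sn i).
have DZ (i : 'I_d) (a : R) y : 0 < a ->
    dual_coord_norm N i.+1 (a *: y) = a * dual_coord_norm N i.+1 y.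
  by case: (hD i) => _ _ hZ _ a0; rewrite hZ gtr0_norm.
apply/seteqP; split=> [y /dual_phi_inf_conv_le h i _|y h].
  exists ((phi (lift ord0 i))^-1 *: y); last first.
    by rewrite scalerA mulfV ?scale1r// gt_eqF.
  by rewrite /dual_coord_ball/= DZ ?invr_gt0// mulrC.
apply/dual_phi_inf_conv_le => i; have [w /= Dw <-] := h i I.
by rewrite DZ// mulrAC mulfV ?mul1r// gt_eqF.
Qed.

End PhiNorm.

Theorem proposition5p1 (R : realType) (d : nat) (hd : (0 < d)%N)
    (nrm : 'rV[R]_d -> R) (hnrm : is_norm nrm)
    (phi : 'I_d.+1 -> R)
    (phi_ge0 : forall j, 0 <= phi j)
    (phi0 : phi ord0 = 0)
    (phi_gt : forall j : 'I_d.+1, j != ord0 -> phi ord0 < phi j) :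
  exists N : 'rV[R]_d -> R,
    [/\ is_norm N,
        [/\ dual_ball N = phi_ball nrm phi
              /\ (forall x, (N x)%:E = support_fun (dual_ball N) x),
            forall y, dual_norm N y = phi_dual_norm nrm phi y
          & forall x, N x = phi_inf_conv nrm phi x],
        forall N' : 'rV[R]_d -> R, is_norm N' ->
          [\/ dual_ball N' = phi_ball nrm phi,
              forall y, dual_norm N' y = phi_dual_norm nrm phi y
            | forall x, N' x = phi_inf_conv nrm phi x] ->
          forall x, N' x = N x
      & forall x : 'rV[R]_d, x != 0 ->
          exists m : R,
            [/\ is_min
                  [set phi_cost nrm phi z
                  | z in [set z : 'I_d -> 'rV[R]_d |
                      \sum_(i < d) coord_norm nrm i.+1 (z i) <= nrm x
                      /\ \sum_(i < d) z i = x]] m,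
                N x / nrm x <= (nrm x)^-1 * m
              & (nrm x)^-1 * m <= phi (l0 x)]].
Proof.
have phi_gt0 (i : 'I_d) : 0 < phi (lift ord0 i).
  by rewrite -phi0 phi_gt// eq_sym neq_lift.
have hN := phi_inf_conv_is_norm hd hnrm phi_gt0.
have ballN := dual_ball_phi_inf_conv hd hnrm phi_gt0.
have dualN := dual_phi_inf_conv hd hnrm phi_gt0.
exists (phi_inf_conv nrm phi); split=> //.
- by split=> //; split=> // x; exact: norm_support_fun.
- move=> N' hN' [eq_ball|eq_dual|//] x.
    by rewrite (norm_eq_of_dual_ball hN hN')// eq_ball.
  rewrite (norm_eq_of_dual_ball hN hN')//.
  by rewrite /dual_ball; apply/seteqP; split=> y /=; rewrite eq_dual dualN.
move=> x x0.
have Nx : 0 < nrm x by exact: norm_gt0.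
have hC (i : 'I_d) := coord_norm_is_norm hnrm (ltn0Sn i).
have sC i := is_norm_seminorm (hC i).
have sP i := is_norm_seminorm (scaled_norm_is_norm (phi_gt0 i) (hC i)).
have l0_gt0 := l0_count_gt0 x0.
(* The zero-based index whose coordinate norm has order [l0 x]. *)
have [i il0] : exists i : 'I_d, lift ord0 i = l0 x.
  have lt : ((l0_count x).-1 < d)%N by rewrite prednK// -ltnS l0_count_ltn.
  by exists (Ordinal lt); apply: val_inj; rewrite /= /bump/= add1n prednK.
have iE : i.+1 = l0_count x by rewrite -[RHS]/(val (l0 x)) -il0.
have Cx : coord_norm nrm i.+1 x <= nrm x by rewrite iE coord_norm_sparse.
have Fx : \sum_(j < d) coord_norm nrm j.+1 (single i x j) <= nrm x /\
    \sum_(j < d) single i x j = x.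
  by rewrite sum_single (sum_norm_single i x sC).
have [|m m_min] := constrained_min (x := x) (r := nrm x) sP hC.
  by exists (single i x).
exists m; split=> //; case: m_min => -[z [_ zx] <-] lb.
  by rewrite mulrC ler_pM2l ?invr_gt0// phi_inf_conv_le.
rewrite ler_pdivrMl//.
have := lb _ (imageP _ Fx); rewrite (sum_norm_single i x sP) il0 => /le_trans.
by apply; rewrite mulrC ler_wpM2r// -il0 ltW.
Qed.
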